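(* Let $r=(r_1,\ldots,r_\ell)$ be a list of points of $\mathbb{R}^m$ and let $F_r^2:\mathbb{R}^m\to\mathbb{R}^\ell$ be given by $F_r^2(x)=(\|x-r_1\|^2,\ldots,\|x-r_\ell\|^2)$. Then: (1) if $\ell\geq m+1$ and $\operatorname{Aff}(r_1,\ldots,r_\ell)=\mathbb{R}^m$, then $F_r^2$ is a diffeomorphism from $\mathbb{R}^m$ onto its image $F_r^2(\mathbb{R}^m)\subset\mathbb{R}^\ell$; (2) if $\ell=m$ and $r_1,\ldots,r_m$ are affinely independent, then $F_r^2$ restricts to a diffeomorphism (onto its image) on each of the two open halfspaces delimited by the affine hyperplane $H^0=\operatorname{Aff}(r_1,\ldots,r_m)$.
   Context: $\mathbb{R}^m$ carries the standard Euclidean norm $\|\cdot\|$. $\operatorname{Aff}(\cdot)$ denotes the affine hull. ''Diffeomorphism onto its image'' means: smooth, injective, with differential of rank $m$ at every point, and a homeomorphism onto the image (so that the image is a smooth $m$-dimensional submanifold of $\mathbb{R}^\ell$ and the inverse is smooth). The two open halfspaces delimited by a hyperplane are the two connected components of its complement in $\mathbb{R}^m$. *)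

(* Defs.v *)
From HB Require Import structures.
From mathcomp Require Import all_boot all_order all_algebra.
From mathcomp Require Import all_classical all_reals all_analysis.

Set Implicit Arguments.
Unset Strict Implicit.
Unset Printing Implicit Defensive.

Import Order.TTheory GRing.Theory Num.Theory.
Import numFieldNormedType.Exports.

Local Open Scope classical_set_scope.
Local Open Scope ring_scope.

(* The library norm on 'rV[R]_m is the sup norm; it induces the same topology
   and the same notion of differentiability. *)
Definition enorm (R : realType) (m : nat) (x : 'rV[R]_m) : R :=
  Num.sqrt (\sum_(i < m) x 0 i ^+ 2).

Definition sqdist_map (R : realType) (m l : nat) (r : 'I_l -> 'rV[R]_m)
    (x : 'rV[R]_m) : 'rV[R]_l :=
  \row_(i < l) enorm (x - r i) ^+ 2.

Definition Aff (R : realType) (m l : nat) (r : 'I_l -> 'rV[R]_m) :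
    set 'rV[R]_m :=
  [set x | exists2 c : 'I_l -> R,
     \sum_(i < l) c i = 1 & x = \sum_(i < l) c i *: r i].

Definition affinely_independent (R : realType) (m l : nat)
    (r : 'I_l -> 'rV[R]_m) : Prop :=
  forall c : 'I_l -> R,
    \sum_(i < l) c i = 0 -> \sum_(i < l) c i *: r i = 0 ->
    forall i, c i = 0.

Definition open_halfspaces (R : realType) (m : nat) (H : set 'rV[R]_m) :
    set (set 'rV[R]_m) :=
  [set connected_component (~` H) x | x in ~` H].

(* Differentiability and continuity are taken at the points of U in the ambient
   space, so U is meant to be open. *)
Fixpoint Ck_on (R : realType) (m l k : nat) (U : set 'rV[R]_m)
    (f : 'rV[R]_m -> 'rV[R]_l) : Prop :=
  match k with
  | 0 => forall x, U x -> {for x, continuous f}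
  | k'.+1 => (forall x, U x -> differentiable f x) /\
             (forall v, Ck_on k' U ('D_v f))
  end.

Definition smooth_on (R : realType) (m l : nat) (U : set 'rV[R]_m)
    (f : 'rV[R]_m -> 'rV[R]_l) : Prop :=
  forall k, Ck_on k U f.

Definition homeo_onto_image (R : realType) (m l : nat) (U : set 'rV[R]_m)
    (f : 'rV[R]_m -> 'rV[R]_l) : Prop :=
  {within U, continuous f} /\
  exists g : 'rV[R]_l -> 'rV[R]_m,
    (forall x, U x -> g (f x) = x) /\ {within f @` U, continuous g}.

Definition diffeo_onto_image (R : realType) (m l : nat) (U : set 'rV[R]_m)
    (f : 'rV[R]_m -> 'rV[R]_l) : Prop :=
  [/\ smooth_on U f,
      (forall x y, U x -> U y -> f x = f y -> x = y),
      (forall x, U x -> \rank (jacobian f x) = m)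
    & homeo_onto_image U f].

(* Main.v *)
Require Import Defs.
From HB Require Import structures.
From mathcomp Require Import all_boot all_order all_algebra.
From mathcomp Require Import all_classical all_reals all_analysis.
From mathcomp Require Import ring lra.
Import Order.TTheory GRing.Theory Num.Theory.
Import numFieldNormedType.Exports.
Local Open Scope classical_set_scope.
Local Open Scope ring_scope.

(* Write [A] for the matrix with columns [r i] and [u] for the row of ones, so that
   the map is [F x = |x|^2 u - 2 x A + d].  If [u C = 0] then [F x C] is affine in [x]
   and determines [x A C].
   (1) If the points span, some such [C] satisfies [A C = 1], so [x] is an affine
   function of [F x].
   (2) If the points span a hyperplane [x . n = b] with [|n| = 1], some such [C]
   satisfies [A C = 1 - n^T n], so [F x] determines the orthogonal projection [h] of
   [x] on the hyperplane; by Pythagoras the distance from [x] to [h] is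
   [sqrt (|x - r 0|^2 - |h - r 0|^2)], and the side of the hyperplane gives its sign.
   Multiplying the differential by [C] shows that its kernel is [0] in (1) and lies in
   the line of [n] in (2), where [D_n F = 2 (x . n - b) u] does not vanish off the
   hyperplane. *)

Set Implicit Arguments.
Unset Strict Implicit.

Definition dot (R : realType) (m : nat) (x y : 'rV[R]_m) : R := (x *m y^T) 0 0.

Definition point_mx (R : realType) (m l : nat) (r : 'I_l -> 'rV[R]_m) : 'M[R]_(m, l) :=
  \matrix_(j, i) r i 0 j.

(** * The Euclidean inner product on row vectors *)

Section Dot.
Variables (R : realType) (m : nat).
Implicit Types x y z : 'rV[R]_m.

Lemma dotE x y : dot x y = \sum_j x 0 j * y 0 j.
Proof. by rewrite /dot mxE; apply: eq_bigr => j _; rewrite mxE. Qed.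

Lemma dotC x y : dot x y = dot y x.
Proof. by rewrite !dotE; apply: eq_bigr => j _; rewrite mulrC. Qed.

Lemma dotDl x y z : dot (x + y) z = dot x z + dot y z.
Proof. by rewrite /dot mulmxDl mxE. Qed.

Lemma dotZl a x z : dot (a *: x) z = a * dot x z.
Proof. by rewrite /dot -scalemxAl mxE. Qed.

Lemma dotNl x z : dot (- x) z = - dot x z.
Proof. by rewrite -scaleN1r dotZl mulN1r. Qed.

Lemma dotDr x y z : dot z (x + y) = dot z x + dot z y.
Proof. by rewrite !(dotC z) dotDl. Qed.

Lemma dotZr a x z : dot z (a *: x) = a * dot z x.
Proof. by rewrite !(dotC z) dotZl. Qed.

Lemma dotNr x z : dot z (- x) = - dot z x.
Proof. by rewrite !(dotC z) dotNl. Qed.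

Lemma dot_ge0 x : 0 <= dot x x.
Proof. by rewrite dotE sumr_ge0// => j _; rewrite -expr2 sqr_ge0. Qed.

Lemma dot_eq0 x : dot x x = 0 -> x = 0.
Proof.
rewrite dotE => /psumr_eq0P x0; apply/rowP => j; rewrite mxE; apply/eqP.
by rewrite -sqrf_eq0 expr2 x0// => i _; rewrite -expr2 sqr_ge0.
Qed.

Lemma mulmx_trE x y : x *m y^T = (dot x y)%:M.
Proof. exact: mx11_scalar. Qed.

Lemma enorm_sqr x : enorm x ^+ 2 = dot x x.
Proof.
by rewrite /enorm -dotE sqr_sqrtr ?dot_ge0.
Qed.

End Dot.

(** * Derivatives of affine maps and of the squared norm *)

Section Calculus.
Variables (R : realType) (m l : nat).

Lemma differentiable_mulmx (A : 'M[R]_(m, l)) (x : 'rV[R]_m) :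
  differentiable (mulmxr A : 'rV[R]_m -> 'rV[R]_l) x.
Proof.
suff -> : (mulmxr A : 'rV[R]_m -> 'rV[R]_l) =
    \sum_(i < m) (fun y : 'rV[R]_m => y 0 i *: row i A).
  apply: differentiable_sum => i.
  apply: (@differentiable_comp _ _ _ _ (fun y : 'rV[R]_m => y 0 i) ( *:%R^~ (row i A))) => //.
  exact: differentiable_coord.
by apply/funext => y; rewrite fct_sumE /= mulmx_sum_row.
Qed.

Lemma derive_mulmx (A : 'M[R]_(m, l)) (x v : 'rV[R]_m) :
  'D_v (mulmxr A : 'rV[R]_m -> 'rV[R]_l) x = v *m A.
Proof.
rewrite deriveE; last exact: differentiable_mulmx.
rewrite diff_lin//= => y; exact/differentiable_continuous/differentiable_mulmx.
Qed.

(** The derivative along [v] is the constant [v *m A], again affine with matrix 0; the induction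
    therefore runs over all [A] and [c]. *)
Lemma smooth_affine (U : set 'rV[R]_m) (A : 'M[R]_(m, l)) (c : 'rV[R]_l) :
  smooth_on U (fun x => x *m A + c).
Proof.
have dA B d (x : 'rV[R]_m) : differentiable (fun x => x *m B + d : 'rV[R]_l) x.
  by apply: (@differentiableD _ _ _ (mulmxr B) (cst d)) => //; exact: differentiable_mulmx.
move=> k; elim: k A c => [|k IH] A c /=; first by move=> x _; exact/differentiable_continuous.
split=> [x _ //|v].
suff -> : 'D_v (fun x => x *m A + c : 'rV[R]_l) = fun x => x *m 0 + v *m A by exact: IH.
apply/funext => x.
rewrite (@deriveD _ _ _ (mulmxr A) (cst c)); [|exact/diff_derivable/differentiable_mulmx|by []].
by rewrite derive_mulmx derive_cst mulmx0 addr0 add0r.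
Qed.

Lemma derive_coord (x v : 'rV[R]_m) (j : 'I_m) :
  'D_v (fun y : 'rV[R]_m => y 0 j) x = v 0 j.
Proof.
have coord_linear : linear (fun y : 'rV[R]_m => y 0 j : R) by move=> a y z; rewrite !mxE.
pose coordM := GRing.isLinear.Build _ _ _ _ _ coord_linear.
pose coord : {linear 'rV[R]_m -> R} := HB.pack (fun y : 'rV[R]_m => y 0 j) coordM.
rewrite deriveE; last exact: differentiable_coord.
rewrite (_ : (fun y : 'rV[R]_m => y 0 j) = coord)// diff_lin//.
exact: coord_continuous.
Qed.

Lemma dot_sum_sqr :
  (fun y : 'rV[R]_m => dot y y) = \sum_(j < m) (fun y : 'rV[R]_m => y 0 j) ^+ 2.
Proof. by apply/funext => y; rewrite dotE fct_sumE; apply: eq_bigr => j _; rewrite expr2. Qed.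

Lemma differentiable_dot (x : 'rV[R]_m) : differentiable (fun y : 'rV[R]_m => dot y y) x.
Proof.
rewrite dot_sum_sqr; apply: differentiable_sum => j.
exact/differentiableX/differentiable_coord.
Qed.

Lemma derive_dot (x v : 'rV[R]_m) : 'D_v (fun y : 'rV[R]_m => dot y y) x = 2 * dot x v.
Proof.
rewrite dot_sum_sqr derive_sum => [|j]; last first.
  exact/diff_derivable/differentiableX/differentiable_coord.
rewrite dotE mulr_sumr; apply: eq_bigr => j _.
rewrite deriveX; last exact/diff_derivable/differentiable_coord.
by rewrite derive_coord -[_ *: _]/(_ * _) expr1; ring.
Qed.

Lemma differentiable_dotZ (w : 'rV[R]_l) (x : 'rV[R]_m) :
  differentiable (fun y : 'rV[R]_m => dot y y *: w) x.
Proof.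
apply: (@differentiable_comp _ _ _ _ (fun y : 'rV[R]_m => dot y y) ( *:%R^~ w)) => //.
exact: differentiable_dot.
Qed.

Lemma derive_dotZ (w : 'rV[R]_l) (x v : 'rV[R]_m) :
  'D_v (fun y : 'rV[R]_m => dot y y *: w) x = (2 * dot x v) *: w.
Proof.
rewrite deriveE; last exact: differentiable_dotZ.
rewrite (@diff_comp _ _ _ _ (fun y : 'rV[R]_m => dot y y) ( *:%R^~ w))//=; last first.
  exact: differentiable_dot.
by rewrite diff_val -deriveE ?derive_dot//; exact: differentiable_dot.
Qed.

End Calculus.

(** * The squared distance map and the spanning case *)

Section SqdistMap.
Variables (R : realType) (m l : nat) (r : 'I_l -> 'rV[R]_m).

Lemma sqdist_mapE x :
  sqdist_map r x = dot x x *: const_mx 1 - 2 *: (x *m point_mx r) + \row_i dot (r i) (r i).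
Proof.
apply/rowP => i; rewrite !mxE enorm_sqr.
have -> : \sum_j x 0 j * point_mx r j i = dot x (r i).
  by rewrite dotE; apply: eq_bigr => j _; rewrite mxE.
rewrite !(dotDl, dotDr, dotNl, dotNr) (dotC (r i) x); ring.
Qed.

Lemma differentiable_sqdist_map x : differentiable (sqdist_map r) x.
Proof.
rewrite (funext sqdist_mapE).
apply: differentiableD => //; apply: differentiableB.
  exact: differentiable_dotZ.
exact/differentiableZ/differentiable_mulmx.
Qed.

Lemma derive_sqdist_map v x :
  'D_v (sqdist_map r) x = (2 * dot x v) *: const_mx 1 - 2 *: (v *m point_mx r).
Proof.
rewrite (funext sqdist_mapE).
have dL := differentiable_mulmx (point_mx r) x.
have dq := differentiable_dotZ (const_mx 1) x.
rewrite deriveD//; last exact/diff_derivable/differentiableB/differentiableZ.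
rewrite deriveB//; [|exact: diff_derivable|exact/diff_derivable/differentiableZ].
rewrite deriveZ; last exact/diff_derivable.
by rewrite derive_dotZ derive_mulmx derive_cst addr0.
Qed.

(** One derivative turns the quadratic map into an affine one. *)
Lemma smooth_sqdist_map U : smooth_on U (sqdist_map r).
Proof.
case=> [|k] /=.
  by move=> x _; exact/differentiable_continuous/differentiable_sqdist_map.
split=> [x _|v]; first exact: differentiable_sqdist_map.
suff -> : 'D_v (sqdist_map r) =
    fun x => x *m (2 *: (v^T *m const_mx 1)) + - (2 *: (v *m point_mx r)).
  exact: smooth_affine.
apply/funext => x; rewrite derive_sqdist_map -scalemxAr mulmxA mulmx_trE.
by rewrite mul_scalar_mx scalerA.
Qed.

(** Reduces both cases to a left inverse on [U], continuous on the whole target, and a differential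
    with trivial kernel. *)
Lemma sqdist_map_diffeo U (g : 'rV[R]_l -> 'rV[R]_m) :
  (forall x, U x -> g (sqdist_map r x) = x) -> continuous g ->
  (forall x v, U x -> 'D_v (sqdist_map r) x = 0 -> v = 0) ->
  diffeo_onto_image U (sqdist_map r).
Proof.
move=> gK cg kerD; split.
- exact: smooth_sqdist_map.
- by move=> x y Ux Uy fxy; rewrite -(gK x Ux) fxy gK.
(* The jacobian acts on row vectors from the right, so rank [m] means a trivial left kernel. *)
- move=> x Ux; apply/eqP; rewrite -[_ == _]/(row_free _) -kermx_eq0.
  apply/rowV0P => v /sub_kermxP vJ0; apply: (kerD x) => //.
  by rewrite deriveEjacobian//; exact: differentiable_sqdist_map.
- split.
    apply: continuous_subspaceT => x.
    exact/differentiable_continuous/differentiable_sqdist_map.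
  by exists g; split=> //; exact: continuous_subspaceT.
Qed.

Lemma sqdist_map_mul p (C : 'M[R]_(l, p)) : (const_mx 1 : 'rV_l) *m C = 0 ->
  forall x, x *m point_mx r *m C =
    2^-1 *: ((\row_i dot (r i) (r i) - sqdist_map r x) *m C).
Proof.
move=> uC x; rewrite sqdist_mapE mulmxBl !mulmxDl mulNmx -!scalemxAl uC scaler0 add0r.
by rewrite opprD opprK addrCA subrr addr0 scalerA mulVf// scale1r.
Qed.

Lemma ker_derive_sqdist_map p (C : 'M[R]_(l, p)) : (const_mx 1 : 'rV_l) *m C = 0 ->
  forall x v, 'D_v (sqdist_map r) x = 0 -> v *m point_mx r *m C = 0.
Proof.
move=> uC x v; rewrite derive_sqdist_map => /(congr1 (mulmx^~ C)).
rewrite mul0mx mulmxBl -!scalemxAl uC scaler0 sub0r => /eqP.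
by rewrite oppr_eq0 scaler_eq0 pnatr_eq0/= => /eqP.
Qed.

Lemma point_mx_mul p (C : 'M[R]_(l, p)) j i :
  (point_mx r *m C) j i = (\sum_k C k i *: r k) 0 j.
Proof.
rewrite mxE summxE; apply: eq_bigr => k _; rewrite !mxE; exact: mulrC.
Qed.

Lemma ones_mul p (C : 'M[R]_(l, p)) i :
  ((const_mx 1 : 'rV_l) *m C) 0 i = \sum_k C k i.
Proof. by rewrite mxE; apply: eq_bigr => k _; rewrite mxE mul1r. Qed.

(** Column [j] of [C] is the difference of affine coefficients of the basis vector [delta_mx 0 j]
    and of the origin: it sums to 0 and combines the points into that basis vector. *)
Lemma Aff_full_right_inverse : Aff r = [set: 'rV[R]_m] ->
  exists C : 'M[R]_(l, m),
    (const_mx 1 : 'rV_l) *m C = 0 /\ point_mx r *m C = 1%:M.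
Proof.
move=> AT.
have /choice[c cP] (x : 'rV[R]_m) : exists c : 'I_l -> R,
    \sum_i c i = 1 /\ x = \sum_i c i *: r i.
  have [c c1 xE] : Aff r x by rewrite AT.
  by exists c.
exists (\matrix_(i, j) (c (delta_mx 0 j) i - c 0 i)); split.
  apply/rowP => j; rewrite ones_mul mxE.
  under eq_bigr do rewrite mxE.
  by rewrite sumrB (cP _).1 (cP _).1 subrr.
apply/matrixP => i j; rewrite point_mx_mul.
under eq_bigr do rewrite mxE scalerBl.
by rewrite sumrB -(cP _).2 -(cP 0).2 subr0 !mxE eqxx.
Qed.

Lemma continuous_mulmx_add p q (B : 'M[R]_(p, q)) (d : 'rV[R]_q) :
  continuous (fun y : 'rV[R]_p => y *m B + d).
Proof. by move=> y; exact: (@smooth_affine _ _ _ setT B d 0%N y). Qed.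

Lemma sqdist_map_diffeo_full :
  Aff r = [set: 'rV[R]_m] -> diffeo_onto_image setT (sqdist_map r).
Proof.
move=> /Aff_full_right_inverse[C [uC AC]].
pose d : 'rV[R]_l := \row_i dot (r i) (r i).
(* With [A C = 1], this is [sqdist_map_mul] solved for [x]. *)
apply: (@sqdist_map_diffeo _ (fun y : 'rV[R]_l => y *m (- 2^-1 *: C) + 2^-1 *: (d *m C))).
- move=> x _; rewrite -[RHS]mulmx1 -AC mulmxA (sqdist_map_mul uC).
  by rewrite mulmxBl scalerBr -scalemxAr scaleNr addrC.
- exact: continuous_mulmx_add.
- by move=> x v _ /(ker_derive_sqdist_map uC); rewrite -mulmxA AC mulmx1.
Qed.

End SqdistMap.

(** * Affinely independent points, as many as the dimension *)

Section Hyperplane.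
Variables (R : realType) (m : nat) (r : 'I_m.+1 -> 'rV[R]_m.+1).
Let u : 'rV[R]_m.+1 := const_mx 1.
Let A := point_mx r.

Hypothesis indep : affinely_independent r.

(** The rows are the lifted points [(1, r i)], and affine independence is linear independence of
    these. *)
Lemma affinely_independent_row_free : row_free (row_mx u^T A^T).
Proof.
rewrite -kermx_eq0; apply/rowV0P => v /sub_kermxP.
rewrite mul_mx_row -[0](row_mx0 R 1 1 m.+1) => /eq_row_mx[vu vA].
have vE k : v 0 k = 0.
  apply: (indep (c := fun i => v 0 i)).
    move/matrixP/(_ 0 0): vu; rewrite !mxE => vu; rewrite -[RHS]vu.
    by apply: eq_bigr => i _; rewrite !mxE mulr1.
  apply/rowP => j; move/matrixP/(_ 0 j): vA; rewrite !mxE => vA; rewrite -[RHS]vA.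
  by rewrite summxE; apply: eq_bigr => i _; rewrite !mxE.
by apply/rowP => k; rewrite vE mxE.
Qed.

Lemma hyperplane_normal : exists n : 'rV[R]_m.+1, exists b : R, exists C : 'M[R]_m.+1,
  [/\ dot n n = 1, n *m A = b *: u, u *m C = 0 & A *m C = 1%:M - n^T *m n].
Proof.
set N := row_mx u^T A^T.
have [n [b [nn nA]]] : exists n : 'rV[R]_m.+1, exists b : R,
    dot n n = 1 /\ n *m A = b *: u.
  (* [N] has one more column than rows, so some nonzero [(a, n)] satisfies [a u + n A = 0]; if [n]
     were 0, [a] would be 0 too. Dividing by the length of [n] gives the unit normal. *)
  have /rowV0Pn[k /sub_kermxP kN k0] : kermx N^T != 0.
    rewrite kermx_eq0 /row_free neq_ltn ltnS; apply/orP; left.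
    by rewrite -ltnS; apply: (leq_ltn_trans (rank_leq_col _)).
  move: kN k0; rewrite -(hsubmxK (k : 'rV_(1 + m.+1))).
  set a := lsubmx _; set n := rsubmx _.
  rewrite tr_row_mx !trmxK mul_row_col [a]mx11_scalar mul_scalar_mx => kN k0.
  have n0 : dot n n != 0.
    apply: contra k0 => /eqP/dot_eq0 nn0; move: kN.
    rewrite nn0 mul0mx addr0 => /rowP/(_ 0); rewrite !mxE mulr1 => ->.
    by rewrite raddf0 row_mx0.
  have sn0 : Num.sqrt (dot n n) != 0 by rewrite sqrtr_eq0 -ltNge lt0r n0 dot_ge0.
  exists ((Num.sqrt (dot n n))^-1 *: n), (- (Num.sqrt (dot n n))^-1 * a 0 0); split.
    rewrite dotZl dotZr -{3}(sqr_sqrtr (dot_ge0 n)) expr2.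
    by rewrite (mulKf sn0) mulVf.
  rewrite -scalemxAl; move/eqP: kN; rewrite addrC addr_eq0 => /eqP ->.
  by rewrite scalerN -scaleNr scalerA.
exists n, b.
(* [k] spans the orthogonal complement of the rows of [N]. *)
set k := row_mx (- b)%:M n.
have Nk : N *m k^T = 0.
  rewrite /N tr_row_mx mul_row_col tr_scalar_mx mul_mx_scalar -trmx_mul nA.
  by rewrite linearZ/= scaleNr addNr.
have kk : k *m k^T = (b ^+ 2 + 1)%:M.
  rewrite tr_row_mx mul_row_col tr_scalar_mx -scalar_mxM mulmx_trE nn -raddfD/=.
  by rewrite mulrNN expr2.
have b1 : b ^+ 2 + 1 != 0 by rewrite gt_eqF// ltr_wpDl// sqr_ge0.
(* The rows of [N] are independent and [k] is nonzero and orthogonal to them, so this square matrix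
   is invertible. *)
have Sfull : row_full (col_mx N k).
  rewrite /row_full; suff : row_free (col_mx N k).
    by rewrite /row_free => /eqP ->; rewrite addn1.
  rewrite -kermx_eq0; apply/rowV0P => w /sub_kermxP.
  rewrite -(hsubmxK w); set w1 := lsubmx _; set w2 := rsubmx _.
  rewrite mul_row_col => wS.
  have w20 : w2 = 0.
    move: (congr1 (mulmx^~ k^T) wS).
    rewrite mulmxDl -mulmxA Nk mulmx0 add0r -mulmxA kk mul0mx mul_mx_scalar => /eqP.
    by rewrite scaler_eq0 (negbTE b1) => /eqP.
  move: wS; rewrite w20 mul0mx addr0 => /eqP.
  rewrite mulmx_free_eq0 ?affinely_independent_row_free// => /eqP ->.
  by rewrite row_mx0.
have /submxP[D DE] : (row_mx 0 (1%:M - n^T *m n) <= col_mx N k)%MS by exact: submx_full.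
move: DE; rewrite -(hsubmxK D); set D1 := lsubmx _; set D2 := rsubmx _.
rewrite mul_row_col => DE.
(* The rows of [(0, 1 - n^T n)] are orthogonal to [k] because [n] is a unit vector, so they combine
   the rows of [N] alone; the transposed coefficients form [C]. *)
have D20 : D2 = 0.
  move: (congr1 (mulmx^~ k^T) DE).
  rewrite mulmxDl -(mulmxA D1) Nk mulmx0 add0r -mulmxA kk tr_row_mx mul_row_col.
  rewrite mul0mx add0r mulmxBl mul1mx -mulmxA mulmx_trE nn mulmx1 subrr mul_mx_scalar.
  by move/esym/eqP; rewrite scaler_eq0 (negbTE b1) => /eqP.
move: DE; rewrite D20 mul0mx addr0 mul_mx_row => /eq_row_mx[uD AD].
exists D1^T; split=> //.
  by rewrite -[u]trmxK -trmx_mul -uD trmx0.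
by rewrite -[A]trmxK -trmx_mul -AD linearB/= trmx1 trmx_mul trmxK.
Qed.

Variables (n : 'rV[R]_m.+1) (b : R) (C : 'M[R]_m.+1).
Hypotheses (nn : dot n n = 1) (nA : n *m A = b *: u) (uC : u *m C = 0)
  (AC : A *m C = 1%:M - n^T *m n).

Lemma dot_point i : dot (r i) n = b.
Proof.
move/rowP/(_ i): nA; rewrite !mxE mulr1 => <-.
by rewrite dotE; apply: eq_bigr => j _; rewrite mxE mulrC.
Qed.

(** The vector [v = x - r 0] is orthogonal to [n], hence fixed by the projection [A C]. So the
    coefficients [v *m C^T] sum to 0 and combine the points into [v]; weight 1 on [r 0] is added. *)
Lemma hyperplane_sub_Aff x : dot x n = b -> Aff r x.
Proof.
move=> xn; pose v := x - r 0.
have vn : dot v n = 0 by rewrite dotDl dotNl dot_point xn subrr.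
exists (fun i => (i == 0)%:R + (v *m C^T) 0 i).
  rewrite big_split/= (bigD1 0)//= big1 ?addr0; last by move=> i /negbTE ->.
  suff -> : \sum_i (v *m C^T) 0 i = (v *m (u *m C)^T) 0 0.
    by rewrite uC trmx0 mulmx0 mxE addr0.
  rewrite trmx_mul mulmxA mxE.
  by apply: eq_bigr => i _; rewrite [_^T _ _]mxE [u _ _]mxE mulr1.
under eq_bigr do rewrite scalerDl.
rewrite big_split/= (bigD1 0)//= scale1r big1 ?addr0; last first.
  by move=> i /negbTE ->; rewrite scale0r.
suff -> : \sum_i (v *m C^T) 0 i *: r i = v by rewrite addrC subrK.
transitivity (v *m (A *m C)^T).
  rewrite trmx_mul mulmxA; apply/rowP => j; rewrite summxE mxE.
  by apply: eq_bigr => i _; rewrite !mxE.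
by rewrite AC linearB/= trmx1 trmx_mul trmxK mulmxBr mulmx1 mulmxA mulmx_trE vn
  raddf0 mul0mx subr0.
Qed.

(** The sign [s] names the side of the hyperplane, so [s * (dot x n - b)] is the distance of [x] to
    it. *)
Lemma sqdist_map_diffeo_side (U : set 'rV[R]_m.+1) (s : R) :
  s ^+ 2 = 1 -> (forall x, U x -> 0 < s * (dot x n - b)) ->
  diffeo_onto_image U (sqdist_map r).
Proof.
move=> s2 sU; pose d : 'rV[R]_m.+1 := \row_i dot (r i) (r i).
have ss : s * s = 1 by rewrite -expr2.
(* [x A C] is the projection on the linear hyperplane orthogonal to [n]; adding [b *: n] moves it to
   the affine one. *)
pose h (y : 'rV[R]_m.+1) := y *m (- 2^-1 *: C) + (2^-1 *: (d *m C) + b *: n).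
have hE x : h (sqdist_map r x) = x - (dot x n - b) *: n.
  have := sqdist_map_mul r uC x.
  rewrite -mulmxA AC mulmxBr mulmx1 mulmxA mulmx_trE mul_scalar_mx => xn.
  have -> : x - (dot x n - b) *: n = x - dot x n *: n + b *: n.
    by rewrite scalerBl opprB addrCA addrC.
  rewrite /h addrA; congr (_ + _).
  by rewrite [RHS]xn mulmxBl scalerBr -scalemxAr scaleNr addrC.
(* Entry 0 of [y] is the squared distance to [r 0]. [Num.sqrt] is 0 on negative numbers and
   continuous everywhere, so [g] is continuous also off the image. *)
pose g y := h y + (s * Num.sqrt (y 0 0 - dot (h y - r 0) (h y - r 0))) *: n.
apply: (@sqdist_map_diffeo _ _ _ _ _ g).
- move=> x Ux; rewrite /g hE; set t := dot x n - b.
  (* Pythagoras: [r 0] lies on the hyperplane and [t] is the signed distance of [x] to it. *)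
  have -> : sqdist_map r x 0 0 - dot (x - t *: n - r 0) (x - t *: n - r 0) = t ^+ 2.
    rewrite mxE enorm_sqr !(dotDl, dotDr, dotNl, dotNr, dotZl, dotZr) nn.
    rewrite (dotC (r 0) x) (dotC n x) (dotC n (r 0)) dot_point /t; ring.
  have -> : t ^+ 2 = (s * t) ^+ 2 by rewrite exprMn s2 mul1r.
  by rewrite sqrtr_sqr gtr0_norm ?sU// mulrA ss mul1r subrK.
- have ch : continuous h by exact: continuous_mulmx_add.
  pose q (y : 'rV[R]_m.+1) := y 0 0 - dot (h y - r 0) (h y - r 0).
  have cq : continuous q.
    move=> y; apply: (continuousB (f := fun z : 'rV[R]_m.+1 => z 0 0)).
      exact: coord_continuous.
    apply: (@continuous_comp _ _ _ (fun z => h z - r 0) (fun z => dot z z)).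
      by apply: (continuousB (g := cst (r 0)) (ch y)); exact: cst_continuous.
    exact/differentiable_continuous/differentiable_dot.
  move=> y; apply: (continuousD (f := h) (ch y)).
  apply: continuousZr_tmp.
  apply: (continuousM (s := cst s) (t := fun z => Num.sqrt (q z))); first exact: cst_continuous.
  by apply: continuous_comp (cq y) _; exact: sqrt_continuous.
- move=> x v Ux dv0; have := ker_derive_sqdist_map uC dv0.
  rewrite -mulmxA AC mulmxBr mulmx1 mulmxA mulmx_trE mul_scalar_mx => /eqP.
  rewrite subr_eq0 => /eqP vE.
  (* Now [v] is a multiple of [n], and the derivative along it becomes [2 (v . n) (x . n - b) u]. *)
  have vA : v *m A = (dot v n * b) *: u by rewrite {1}vE -scalemxAl nA scalerA.
  have xv : dot x v = dot v n * dot x n by rewrite {1}vE dotZr.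
  move: dv0; rewrite derive_sqdist_map -/A vA xv => /rowP/(_ 0).
  rewrite !mxE !mulr1 => dv0.
  have t0 : dot x n - b != 0.
    by apply/eqP => t0; have := sU x Ux; rewrite t0 mulr0 ltxx.
  have /eqP : dot v n * (dot x n - b) = 0 by lra.
  by rewrite mulf_eq0 (negbTE t0) orbF => /eqP vn0; rewrite vE vn0 scale0r.
Qed.

End Hyperplane.

(** * From half-spaces to signs, and the conclusion *)

Lemma connected_constant_sign (R : realType) (T : topologicalType) (U : set T)
    (f : T -> R) : connected U -> continuous f -> (forall x, U x -> f x != 0) ->
  exists s : R, s ^+ 2 = 1 /\ forall x, U x -> 0 < s * f x.
Proof.
move=> cU cf f0.
(* The image is an interval avoiding 0, so one positive value forces all values to be positive;
   otherwise all are negative. *)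
have fU : is_interval (f @` U).
  apply/connected_intervalP/connected_continuous_connected => //.
  exact: continuous_subspaceT.
have [[x0 [Ux0 fx0]]|npos] := pselect (exists x, U x /\ 0 < f x).
  exists 1; split; first by rewrite expr1n.
  move=> x Ux; rewrite mul1r ltNge; apply/negP => fx.
  have [|z Uz /eqP] := fU _ _ (imageP f Ux) (imageP f Ux0) 0.
    by rewrite fx ltW.
  by apply/negP/f0.
exists (- 1); split; first by rewrite sqrrN expr1n.
move=> x Ux; rewrite mulN1r oppr_gt0 lt_neqAle f0//= leNgt; apply/negP => fx.
by apply: npos; exists x.
Qed.

Lemma sqdist_map_diffeo_halfspace (R : realType) (m : nat) (r : 'I_m -> 'rV[R]_m)
    (U : set 'rV[R]_m) : affinely_independent r -> open_halfspaces (Aff r) U ->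
  diffeo_onto_image U (sqdist_map r).
Proof.
case: m r U => [|m] r U indep [p pH <-].
  (* In dimension 0 every vector is 0, so the constant map is an inverse. *)
  apply: (@sqdist_map_diffeo _ _ _ _ _ (cst 0)) => [x _||x v _ _].
  - by rewrite [RHS]thinmx0.
  - exact: cst_continuous.
  - exact: thinmx0.
have [n [b [C [nn nA uC AC]]]] := hyperplane_normal indep.
have [||x Ux|s [s2 sU]] := @connected_constant_sign R _
    (connected_component (~` Aff r) p) (fun x => dot x n - b).
- exact: component_connected.
- move=> x; apply: (continuousB (f := fun y : 'rV[R]_m.+1 => dot y n) (g := cst b)); last first.
    exact: cst_continuous.
  apply: (@continuous_comp _ _ _ (fun x : 'rV[R]_m.+1 => x *m n^T) (fun y => y 0 0)).
    exact/differentiable_continuous/differentiable_mulmx.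
  exact: coord_continuous.
(* A zero would lie in [Aff r], which the component avoids. *)
- apply/eqP => /eqP; rewrite subr_eq0 => /eqP/(hyperplane_sub_Aff nA uC AC).
  exact: (connected_component_sub Ux).
- exact: (sqdist_map_diffeo_side nn nA uC AC s2).
Qed.

Theorem theorem1 (R : realType) (m l : nat) (r : 'I_l -> 'rV[R]_m) :
  ((m + 1 <= l)%N -> Aff r = [set: 'rV[R]_m] ->
     diffeo_onto_image [set: 'rV[R]_m] (sqdist_map r)) /\
  (l = m -> affinely_independent r ->
     forall U : set 'rV[R]_m, open_halfspaces (Aff r) U ->
       diffeo_onto_image U (sqdist_map r)).
Proof.
split=> [_|lm]; first exact: sqdist_map_diffeo_full.
by subst l => indep U; exact: sqdist_map_diffeo_halfspace.
Qed.
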